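(* Let $X$ be a shift space over a finite alphabet and let $r\colon X\to(0,\infty)$ be a locally constant roof function with range $\operatorname{Im}(r)$. If the elements of $\operatorname{Im}(r)$ are setwise commensurate, then the suspension flow $\varphi^t$ over $(X,\sigma)$ with roof function $r$ is not topologically mixing.
   Context: Let $A$ be a finite alphabet. $A^{\mathbb{Z}}$ has the metric $d(x,y)=2^{-\min\{|n|: x_n\neq y_n\}}$ (and $d(x,x)=0$), and $\sigma$ is the left shift $(\sigma x)_n=x_{n+1}$. A shift space is a nonempty closed $\sigma$-invariant ($\sigma(X)=X$) set $X\subset A^{\mathbb{Z}}$. A function on $X$ is locally constant if every point of $X$ has a neighborhood on which the function is constant. A set $P\subset\mathbb{R}$ is setwise commensurate if there exists $\delta>0$ with $P\subset\delta\mathbb{Z}=\{\delta n: n\in\mathbb{Z}\}$. Suspension flow: given $r\colon X\to(0,\infty)$, let $M_r=\{(x,t)\in X\times[0,\infty): 0\le t\le r(x)\}/\sim$, with the quotient topology, where $(x,r(x))\sim(\sigma x,0)$. The suspension flow is $\varphi^T(x,s)=(\sigma^n x,s')$, where $n$ and $s'$ satisfy $\sum_{j=0}^{n-1}r(\sigma^jx)+s'=T+s$ and $0\le s'\le r(\sigma^nx)$. It is topologically mixing if for all nonempty open $U,V\subset M_r$ there is $T\in\mathbb{R}$ such that $\varphi^t(U)\cap V\neq\emptyset$ for all $t\ge T$. *)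

(* Defs.v *)
From HB Require Import structures.
From Stdlib Require Import Relation_Operators.
From mathcomp Require Import all_boot all_order all_algebra.
From mathcomp Require Import all_classical all_reals topology normedtype.
From mathcomp Require Import ring lra zify.

Set Implicit Arguments.
Unset Strict Implicit.
Unset Printing Implicit Defensive.

Import Order.TTheory GRing.Theory Num.Theory.
Import numFieldNormedType.Exports.

Local Open Scope quotient_scope.
Local Open Scope classical_set_scope.
Local Open Scope ring_scope.

(* [R] is a phantom parameter: it only fixes the codomain of the metric. *)
Definition full_shift (R : realType) (A : finType) : Type := int -> A.

HB.instance Definition _ (R : realType) (A : finType) :=
  gen_eqMixin (full_shift R A).
HB.instance Definition _ (R : realType) (A : finType) :=
  gen_choiceMixin (full_shift R A).

Section ShiftMetric.
Context {R : realType} {A : finType}.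
Implicit Types x y z : full_shift R A.

Definition differ_at x y (k : nat) : bool :=
  `[< exists n : int, `|n|%N = k /\ x n <> y n >].

Definition shift_dist x y : R :=
  if pselect (exists k, differ_at x y k) is left h then 2 ^- (ex_minn h) else 0.

Lemma differ_atC x y : differ_at x y = differ_at y x.
Proof.
apply/funext => k; apply: asbool_equiv_eq.
by split=> -[n [nk xy]]; exists n; split=> // /esym.
Qed.

Lemma differ_atxx x k : ~ differ_at x x k.
Proof. by move=> /asboolP[n []]. Qed.

Lemma shift_distP x y (e : R) : 0 < e ->
  (forall k, differ_at x y k -> 2 ^- k <= e) <-> shift_dist x y <= e.
Proof.
move=> e0; rewrite /shift_dist; case: pselect => [h|nh].
  case: ex_minnP => m dm mmin; split=> [|me k dk]; first exact.
  apply: le_trans me; rewrite lef_pV2 ?posrE ?exprn_gt0//.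
  by rewrite ler_eXn2l ?ltr1n// mmin.
by split=> _; [exact: ltW|move=> k dk; case: nh; exists k].
Qed.

Lemma shift_dist_ge0 x y : 0 <= shift_dist x y.
Proof. by rewrite /shift_dist; case: pselect => // h; rewrite invr_ge0 exprn_ge0. Qed.

Lemma shift_distxx x : shift_dist x x = 0.
Proof. by rewrite /shift_dist; case: pselect => // h; exfalso; case: h => k /differ_atxx. Qed.

Lemma shift_dist_eq0 x y : shift_dist x y = 0 -> x = y.
Proof.
rewrite /shift_dist; case: pselect => [h|nh _].
  have : (2 ^- ex_minn h : R) != 0 by rewrite invr_eq0 expf_eq0 pnatr_eq0 andbF.
  by move=> + E; rewrite E eqxx.
apply/funext => n; apply: contrapT => xyn; apply: nh.
by exists `|n|%N; apply/asboolP; exists n.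
Qed.

Lemma shift_distC x y : shift_dist x y = shift_dist y x.
Proof. by rewrite /shift_dist differ_atC. Qed.

Lemma shift_dist_triangle y x z :
  shift_dist x z <= shift_dist x y + shift_dist y z.
Proof.
have [xy0|xy0] := eqVneq (shift_dist x y) 0.
  by rewrite xy0 (shift_dist_eq0 xy0) add0r.
have s0 : 0 < shift_dist x y + shift_dist y z.
  by rewrite ltr_wpDr ?shift_dist_ge0// lt_neqAle eq_sym xy0 shift_dist_ge0.
apply/shift_distP => // k /asboolP[n [nk xzn]].
have [xyn|xyn] := pselect (x n = y n).
  have yzk : differ_at y z k by apply/asboolP; exists n; rewrite -xyn.
  have yz0 : 0 < shift_dist y z.
    rewrite lt_neqAle shift_dist_ge0 andbT eq_sym; apply/eqP => /shift_dist_eq0 yz.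
    by apply: xzn; rewrite xyn yz.
  have yzle := (shift_distP y z yz0).2 (lexx _) _ yzk.
  by apply: le_trans yzle _; rewrite lerDr shift_dist_ge0.
have xyk : differ_at x y k by apply/asboolP; exists n.
have xy0' : 0 < shift_dist x y by rewrite lt_neqAle eq_sym xy0 shift_dist_ge0.
have xyle := (shift_distP x y xy0').2 (lexx _) _ xyk.
by apply: le_trans xyle _; rewrite lerDl shift_dist_ge0.
Qed.

End ShiftMetric.

HB.instance Definition _ (R : realType) (A : finType) :=
  isMetric.Build R (full_shift R A) (@shift_distxx R A) (@shift_dist_eq0 R A)
    (@shift_distC R A) (@shift_dist_triangle R A).

Definition shift (R : realType) (A : finType) (x : full_shift R A) :
  full_shift R A := fun n => x (n + 1).

Record shiftSpace (R : realType) (A : finType) := ShiftSpace {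
  shift_set :> set (full_shift R A);
  shift_set_neq0 : shift_set !=set0;
  shift_set_closed : closed shift_set;
  shift_set_invariant : [set shift x | x in shift_set] = shift_set
}.

Section ShiftPowers.
Context {R : realType} {A : finType}.

Definition shift_pow (n : int) (x : full_shift R A) : full_shift R A :=
  fun k => x (k + n).

Lemma shift_pow0 x : shift_pow 0 x = x.
Proof. by apply/funext => k; rewrite /shift_pow addr0. Qed.

Lemma shift_powD m n x : shift_pow (m + n) x = shift_pow m (shift_pow n x).
Proof. by apply/funext => k; rewrite /shift_pow addrA. Qed.

Context {X : shiftSpace R A}.

Lemma shift_pow_mem n (x : full_shift R A) :
  shift_set X x -> shift_set X (shift_pow n x).
Proof.
have fwd y : shift_set X y -> shift_set X (shift_pow 1 y).
  by move=> Xy; rewrite -(shift_set_invariant X); exists y.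
have bwd y : shift_set X y -> shift_set X (shift_pow (-1) y).
  rewrite -{1}(shift_set_invariant X) => -[z Xz <-].
  by rewrite -[shift z]/(shift_pow 1 z) -shift_powD addNr shift_pow0.
move=> Xx; elim/int_ind: n => [|n IH|n IH]; first by rewrite shift_pow0.
  by rewrite intS shift_powD; exact: fwd.
by rewrite intS opprD shift_powD; exact: bwd.
Qed.

(* The power sigma^n of the homeomorphism sigma : X -> X, for n : int. *)
Definition sigma_pow (n : int) (x : X) : X :=
  exist _ (shift_pow n (\val x)) (mem_set (shift_pow_mem n (set_mem (valP x)))).

Definition sigma : X -> X := sigma_pow 1.

Lemma val_sigma x : \val (sigma x) = shift (\val x).
Proof. by []. Qed.

Lemma sigma_pow0 x : sigma_pow 0 x = x.
Proof. by apply/val_inj; rewrite /= shift_pow0. Qed.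

Lemma sigma_powD m n x : sigma_pow (m + n) x = sigma_pow m (sigma_pow n x).
Proof. by apply/val_inj; rewrite /= shift_powD. Qed.

Lemma sigma_pow_nat (n : nat) x : sigma_pow n%:Z x = iter n sigma x.
Proof. by elim: n => [|n IH]; rewrite ?sigma_pow0// intS sigma_powD IH. Qed.

End ShiftPowers.

Definition locally_constant (T : topologicalType) (S : Type) (f : T -> S) :=
  forall x, \forall y \near x, f y = f x.

Definition setwise_commensurate (R : realType) (P : set R) :=
  exists2 delta : R, 0 < delta & P `<=` [set delta * n%:~R | n in [set: int]].

Definition topologically_mixing (R : realType) (M : topologicalType)
    (phi : R -> M -> M) :=
  forall U V : set M, open U -> open V -> U !=set0 -> V !=set0 ->
  exists T : R, forall t, T <= t -> (phi t @` U) `&` V !=set0.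

Section Suspension.
Context {R : realType} {A : finType} {X : shiftSpace R A} (r : X -> R).

Definition under_roof : set (X * R) := [set p | 0 <= p.2 <= r p.1].

Definition glue (p q : under_roof) : Prop :=
  (\val p).2 = r (\val p).1 /\ \val q = (sigma (\val p).1, 0).

Definition roof_equiv (p q : under_roof) : bool :=
  `[< clos_refl_sym_trans _ glue p q >].

Lemma roof_equiv_is_equiv : equiv_class_of roof_equiv.
Proof.
split=> [p|p q|q p s].
- by apply/asboolP/rst_refl.
- by apply: asbool_equiv_eq; split; exact: rst_sym.
- by move=> /asboolP pq /asboolP qs; apply/asboolP; exact: rst_trans pq qs.
Qed.

Canonical roof_equiv_rel := EquivRelPack roof_equiv_is_equiv.

Definition suspension := quotient_topology {eq_quot roof_equiv_rel}.
HB.instance Definition _ := Topological.on suspension.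
HB.instance Definition _ := Quotient.on suspension.

Lemma suspension_eqP (u v : under_roof) :
  \pi_suspension u = \pi_suspension v <-> clos_refl_sym_trans _ glue u v.
Proof.
rewrite -[X in X <-> _]/(\pi_({eq_quot roof_equiv_rel}) u =
  \pi_({eq_quot roof_equiv_rel}) v).
by split=> [/eqmodP/asboolP|uv] //; apply/eqmodP/asboolP.
Qed.

(* The sum of r (sigma^j x) over 0 <= j < n, extended to n < 0 by the cocycle
   relation (see birkhoffS), i.e. as minus the sum over n <= j < 0. *)
Definition birkhoff (n : int) (x : X) : R :=
  match n with
  | Posz k => \sum_(j < k) r (sigma_pow j%:Z x)
  | Negz k => - \sum_(j < k.+1) r (sigma_pow (- j.+1%:Z) x)
  end.

Definition rep_flow (T : R) (u v : under_roof) := exists n : int,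
  (\val v).1 = sigma_pow n (\val u).1 /\
  birkhoff n (\val u).1 + (\val v).2 = T + (\val u).2.

Definition flows_to (T : R) (p q : suspension) := exists u v : under_roof,
  [/\ p = \pi_suspension u, q = \pi_suspension v & rep_flow T u v].

Lemma birkhoffS n x : birkhoff (n + 1) x = birkhoff n x + r (sigma_pow n x).
Proof.
case: n => [k|[|k]].
- rewrite (_ : Posz k + 1 = Posz k.+1); last by lia.
  by rewrite [LHS]big_ord_recr.
- rewrite (_ : Negz 0 + 1 = Posz 0) /=; last by lia.
  by rewrite big_ord0 big_ord1 addNr.
- rewrite (_ : Negz k.+1 + 1 = Negz k); last by lia.
  by rewrite [birkhoff (Negz k.+1) x]/= big_ord_recr/= opprD NegzE addrNK.
Qed.

Lemma birkhoff0 x : birkhoff 0 x = 0.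
Proof. by rewrite /= big_ord0. Qed.

Lemma birkhoff_sigma n x : birkhoff (n + 1) x = r x + birkhoff n (sigma x).
Proof.
elim/int_ind: n => [|n IH|n IH].
- by rewrite birkhoffS !birkhoff0 sigma_pow0 addrC.
- rewrite (_ : n.+1%:Z = n%:Z + 1); last by lia.
  by rewrite birkhoffS IH [in RHS]birkhoffS addrA sigma_powD.
- have := birkhoffS (- n.+1%:Z + 1) x; rewrite (_ : - n.+1%:Z + 1 = - n%:Z); last by lia.
  have := birkhoffS (- n.+1%:Z) (sigma x).
  rewrite (_ : - n.+1%:Z + 1 = - n%:Z); last by lia.
  have -> : sigma_pow (- n.+1%:Z) (sigma x) = sigma_pow (- n%:Z) x.
    by rewrite -[sigma x]/(sigma_pow 1 x) -sigma_powD; congr sigma_pow; lia.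
  by rewrite IH; lra.
Qed.

Lemma rep_flow_glue T u u' v : glue u u' -> rep_flow T u v <-> rep_flow T u' v.
Proof.
move=> [uE u'E]; rewrite /rep_flow uE u'E /=; split=> -[n [v1 v2]].
  exists (n - 1); split.
    by rewrite v1 -[sigma _]/(sigma_pow 1 _) -sigma_powD subrK.
  by move: v2; rewrite -{1}(subrK 1 n) birkhoff_sigma; lra.
exists (n + 1); split; first by rewrite v1 sigma_powD.
by rewrite birkhoff_sigma; lra.
Qed.

Lemma rep_flow_equiv T u u' v :
  \pi_suspension u = \pi_suspension u' -> rep_flow T u v <-> rep_flow T u' v.
Proof.
move=> /suspension_eqP; elim=> {u u'} [u u'||u u' _|u u' u'' _ + _].
- exact: rep_flow_glue.
- by [].
- by move=> [].
- by move=> [? ?] [? ?]; split; auto.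
Qed.

Hypothesis r_gt0 : forall x, 0 < r x.

Lemma birkhoff_lt x m n : (m < n)%R -> birkhoff m x < birkhoff n x.
Proof.
move=> mn; have [k ->] : exists k : nat, n = m + k.+1%:Z.
  by exists (`|n - m|%N.-1); lia.
elim: k => [|k IH]; first by rewrite birkhoffS ltrDl.
rewrite (_ : m + k.+2%:Z = m + k.+1%:Z + 1); last by lia.
by rewrite birkhoffS; apply: (lt_trans IH); rewrite ltrDl.
Qed.

Lemma rep_flow_fun T u v v' : rep_flow T u v -> rep_flow T u v' ->
  \pi_suspension v = \pi_suspension v'.
Proof.
move=> [n [v1 v2]] [n' [v1' v2']].
wlog le_nn' : n n' v v' v1 v2 v1' v2' / n <= n'.
  by move=> H; have [/H|/ltW/H] := leP n n'; [exact|move=> E; apply/esym/E].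
have /andP[v0 vr] := set_mem (valP v); have /andP[v0' vr'] := set_mem (valP v').
have [nn'|ltnn'] : n = n' \/ n + 1 <= n' by lia.
  congr \pi; apply/val_inj; subst n'.
  apply: injective_projections; first by rewrite v1 v1'.
  by apply: (addrI (birkhoff n (\val u).1)); rewrite v2 v2'.
apply/suspension_eqP; apply: rst_step.
have Bn := birkhoffS n (\val u).1; rewrite /= in v0 vr v0' vr' v1 v1' v2 v2'.
rewrite -v1 /= in Bn.
have nn' : n' = n + 1.
  have [//|lt1] : n' = n + 1 \/ n + 1 < n' by lia.
  by exfalso; have /= := birkhoff_lt (\val u).1 lt1; lra.
subst n'; split=> /=; first by lra.
apply: injective_projections => /=; last by lra.
by rewrite v1' v1 addrC sigma_powD.
Qed.

Lemma flows_to_fun T p q q' : flows_to T p q -> flows_to T p q' -> q = q'.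
Proof.
move=> [u [v [-> -> uv]]] [u' [v' [uu' -> uv']]].
by apply: (rep_flow_fun uv); apply/(rep_flow_equiv T v' uu').
Qed.

Lemma flows_to_ex (delta : R) T p : 0 < delta -> (forall x, delta <= r x) ->
  exists q, flows_to T p q.
Proof.
move=> delta0 r_ge; rewrite -[p]reprK; set u := repr p.
set x := (\val u).1; set S := T + (\val u).2.
have Bpos (k : nat) : delta *+ k <= birkhoff k%:Z x.
  elim: k => [|k IH]; first by rewrite birkhoff0.
  by rewrite -addn1 PoszD birkhoffS mulrnDr lerD.
have Bneg (k : nat) : birkhoff (- k%:Z) x <= - (delta *+ k).
  elim: k => [|k IH]; first by rewrite oppr0 birkhoff0 mulr0n oppr0.
  have := birkhoffS (- k.+1%:Z) x; rewrite (_ : - k.+1%:Z + 1 = - k%:Z); last by lia.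
  by have := r_ge (sigma_pow (- k.+1%:Z) x); rewrite mulrS; lra.
pose N := Num.bound (`|S| / delta).
have /ltr_normlP[S1 S2] : `|S| < delta *+ N.
  by rewrite -mulr_natl -ltr_pdivrMr// archi_boundP// divr_ge0// ltW.
have exP : exists m : nat, S < birkhoff (m%:Z - N%:Z) x.
  exists (N + N)%N; rewrite PoszD addrK; exact: lt_le_trans (Bpos N).
case: (ex_minnP exP) => -[|m] mP mmin.
  by move: mP; rewrite sub0r; have := Bneg N; lra.
pose n := m%:Z - N%:Z.
have Sn : birkhoff n x <= S.
  by rewrite leNgt; apply/negP => /mmin; rewrite ltnn.
have nS : n + 1 = m.+1%:Z - N%:Z by rewrite /n; lia.
move: mP; rewrite -nS birkhoffS => Sn1.
have vP : under_roof (sigma_pow n x, S - birkhoff n x).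
  by apply/andP; split => /=; lra.
pose v : under_roof := exist _ (sigma_pow n x, S - birkhoff n x) (mem_set vP).
exists (\pi_suspension v), u, v; split=> //.
by exists n; split=> //=; rewrite addrCA subrr addr0.
Qed.

(* The default value of flow is only used where flows_to T p is empty, which
   flows_to_ex excludes for a roof bounded away from 0, in particular for a
   positive locally constant one, X being compact. *)
Definition flow (T : R) (p : suspension) : suspension := xget p (flows_to T p).

Lemma flowE T p q : flows_to T p q -> flow T p = q.
Proof. by move=> pq; apply: xget_unique => // q' /flows_to_fun -/(_ _ pq). Qed.

End Suspension.

Arguments flows_to {R A X} r T p q.
Arguments flow {R A X} r T p.

(* Main.v *)
Require Import Defs.
From mathcomp Require Import all_boot all_order all_algebra.
From mathcomp Require Import all_classical all_reals topology normedtype.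
From mathcomp Require Import lra zify.

Import Order.TTheory GRing.Theory Num.Theory.
Import numFieldNormedType.Exports.
Local Open Scope classical_set_scope.
Local Open Scope ring_scope.

(** If r takes values in δℤ, the height s of a point (x, s) is well defined
    modulo δ on the suspension, and the flow at time t translates it by t.
    Hence the open set of points whose height lies in (0, δ/2) modulo δ is
    disjoint from its images at all times t in δ/2 + δℤ. *)

Section HalfPhase.
Context {R : realType} (delta : R).
Hypothesis delta_gt0 : 0 < delta.

Definition half_phase : set R :=
  \bigcup_(m in [set: int]) [set` `]delta * m%:~R, delta * m%:~R + delta / 2[].

Lemma half_phase_open : open half_phase.
Proof. by apply: bigcup_open => m _; exact: interval_open. Qed.

Lemma no_multiple_between (k m : int) :
  delta * m%:~R < delta * k%:~R -> delta * k%:~R < delta * (m + 1)%:~R -> False.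
Proof. by rewrite !ltr_pM2l// !ltr_int; lia. Qed.

Lemma half_phase_multiple (k : int) : ~ half_phase (delta * k%:~R).
Proof.
move=> [m _ /=]; rewrite in_itv/= => /andP[mk km].
by apply: (@no_multiple_between k m) => //; rewrite intrD mulrDr; lra.
Qed.

(** Translating by an odd multiple of [delta / 2] moves the lower open half of each period into the
    upper one. *)
Lemma half_phase_shift (k : int) (s s' : R) :
  s' = s + delta * k%:~R + delta / 2 -> half_phase s -> ~ half_phase s'.
Proof.
move=> -> [m _ /=]; rewrite in_itv/= => /andP[ms sm].
move=> [m' _ /=]; rewrite in_itv/= => /andP[ms' sm'].
(* Subtracting the bounds on [s] from those on [s'] puts [k] strictly between [m' - m - 1] and
   [m' - m]. *)
apply: (@no_multiple_between k (m' - m - 1)).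
  by rewrite !intrB !mulrBr; lra.
by rewrite subrK !intrB !mulrBr; lra.
Qed.

End HalfPhase.

Section CommensurateRoof.
Local Open Scope quotient_scope.
Context {R : realType} {A : finType} {X : shiftSpace R A}.
Variables (r : X -> R) (delta : R).
Hypotheses (r_gt0 : forall x, 0 < r x) (delta_gt0 : 0 < delta).
Hypothesis r_multiple : forall x, exists n : int, r x = delta * n%:~R.

(** A positive integer multiple of [delta] is at least [delta]; [flows_to_ex] asks for such a
    uniform bound. *)
Lemma roof_ge x : delta <= r x.
Proof.
have [n rE] := r_multiple x; have := r_gt0 x.
by rewrite rE pmulr_rgt0// ltr0z => n0; rewrite ler_pMr// ler1z; lia.
Qed.

Lemma birkhoff_multiple n x : exists k : int, birkhoff r n x = delta * k%:~R.
Proof.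
elim/int_ind: n => [|n [k IH]|n [k IH]].
- by exists 0; rewrite birkhoff0 mulr0.
- have [m rE] := r_multiple (sigma_pow n x); exists (k + m).
  by rewrite intS addrC birkhoffS IH rE intrD mulrDr.
- have [m rE] := r_multiple (sigma_pow (- n.+1%:Z) x); exists (k - m).
  have := birkhoffS r (- n.+1%:Z) x.
  rewrite (_ : - n.+1%:Z + 1 = - n%:Z); last by lia.
  by rewrite IH rE intrB mulrBr; lra.
Qed.

Definition in_half_phase (u : under_roof r) : Prop :=
  half_phase delta (\val u).2.

(** Gluing joins height [r x] to height [0]; both are multiples of [delta], so neither end is in the
    half phase. *)
Lemma in_half_phase_pi u v : \pi_(suspension r) u = \pi_(suspension r) v ->
  in_half_phase u <-> in_half_phase v.
Proof.
move=> /suspension_eqP; elim=> {u v} [u v [uE vE]||u v _|u v w _ + _].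
- have [n rE] := r_multiple (\val u).1.
  rewrite /in_half_phase uE vE rE /= -[X in _ <-> half_phase _ X](mulr0 delta).
  by split=> H; [have := @half_phase_multiple _ _ delta_gt0 n H
                |have := @half_phase_multiple _ _ delta_gt0 0 H].
- by [].
- by move=> [].
- by move=> [? ?] [? ?]; split; auto.
Qed.

Definition half_phase_set : set (suspension r) :=
  [set p | in_half_phase (repr p)].

Lemma half_phase_setE u : half_phase_set (\pi_(suspension r) u) <-> in_half_phase u.
Proof. by apply: in_half_phase_pi; rewrite reprK. Qed.

Lemma half_phase_set_open : open half_phase_set.
Proof.
(* In the quotient topology, a set is open by definition when its preimage under the projection
   is. *)
change (open (\pi_(suspension r) @^-1` half_phase_set)).
have -> : \pi_(suspension r) @^-1` half_phase_set =
    (fun u : under_roof r => (\val u).2) @^-1` half_phase delta.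
  by apply/seteqP; split=> u /= /half_phase_setE.
apply: open_comp; last exact: half_phase_open.
move=> u _; apply: (@continuous_comp _ _ _ (fun u : under_roof r => \val u) snd).
  exact: initial_continuous.
exact: cvg_snd.
Qed.

Lemma half_phase_set_neq0 : half_phase_set !=set0.
Proof.
have [x0 Xx0] := shift_set_neq0 X.
pose x : X := exist _ x0 (mem_set Xx0).
(* The midpoint of the interval from [0] to [delta / 2] lies below the roof, since
   [delta <= r x]. *)
have uP : under_roof r (x, delta / 4).
  by have := roof_ge x; move: delta_gt0 => ? ?; apply/andP; split => /=; lra.
exists (\pi_(suspension r) (exist _ (x, delta / 4) (mem_set uP))).
apply/half_phase_setE; exists 0 => //=.
by move: delta_gt0 => ?; rewrite in_itv/= mulr0; apply/andP; split; lra.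
Qed.

Lemma flow_half_phase_disjoint (k : int) p : half_phase_set p ->
  ~ half_phase_set (flow r (delta * k%:~R + delta / 2) p).
Proof.
(* As a target [q] exists, [flow] takes its true value here and not the default. *)
have [q pq] := flows_to_ex (delta * k%:~R + delta / 2) p delta_gt0 roof_ge.
rewrite (flowE r_gt0 pq); case: pq => u [v [-> -> [n [_ uv]]]].
have [b bE] := birkhoff_multiple n (\val u).1.
move=> /half_phase_setE Hu /half_phase_setE.
(* The height grows by the elapsed time minus the Birkhoff sum [delta * b]. *)
apply: (@half_phase_shift _ _ delta_gt0 (k - b)) Hu.
by move: uv; rewrite bE intrB mulrBr; lra.
Qed.

End CommensurateRoof.

Theorem theorem3p7 (R : realType) (A : finType) (X : shiftSpace R A)
    (r : X -> R) (r_gt0 : forall x : X, 0 < r x) (r_lc : locally_constant r)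
    (r_comm : setwise_commensurate (range r)) :
  ~ topologically_mixing (flow r).
Proof.
have [delta delta0 r_sub] := r_comm.
have r_multiple x : exists n : int, r x = delta * n%:~R.
  by have [|n _ <-] := r_sub (r x); [exists x | exists n].
move=> mix.
have Uo := half_phase_set_open r delta delta0 r_multiple.
have U0 := half_phase_set_neq0 r delta r_gt0 delta0 r_multiple.
have [T HT] := mix _ _ Uo Uo U0 U0.
(* By the Archimedean property, some forbidden time [delta * k + delta / 2] lies beyond [T]. *)
pose k := Num.bound (`|T| / delta).
have Tk : T <= delta * k%:~R + delta / 2.
  have : `|T| < delta * k%:R.
    by rewrite mulrC -ltr_pdivrMr// archi_boundP// divr_ge0// ltW.
  by have := ler_norm T; rewrite -pmulrn; lra.
have [_ [[p Up <-] Vp]] := HT _ Tk.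
exact: flow_half_phase_disjoint Up Vp.
Qed.
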